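(* Let $r\ge2$ and let $\mathcal{H}$ be a cancellative $r$-graph. Then \[ |\mathcal{H}|\le\left(\frac{|\partial\mathcal{H}|}{r}\right)^{\frac{r}{r-1}}. \]
   Context: An $r$-graph $\mathcal{H}$ is a finite vertex set $V(\mathcal{H})$ together with a set of $r$-element subsets (edges). The shadow is $\partial\mathcal{H}=\{A\in\binom{V(\mathcal{H})}{r-1}: A\subset B\text{ for some }B\in\mathcal{H}\}$. $\mathcal{T}_r$ is the collection of all $r$-graphs on at most $2r-1$ vertices with $3$ edges $A,B,C$ such that $A\triangle B\subset C$; an $r$-graph is cancellative iff it contains no member of $\mathcal{T}_r$ as a (not necessarily induced) subgraph. *)

(* Defs.v *)
From mathcomp Require Import all_boot.

Set Implicit Arguments.
Unset Strict Implicit.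
Unset Printing Implicit Defensive.

Record hypergraph (r : nat) := Hypergraph {
  vertex : finType;
  edges : {set {set vertex}};
  edges_uniform : {in edges, forall e : {set vertex}, #|e| = r} }.

Definition shadow (r : nat) (H : hypergraph r) : {set {set vertex H}} :=
  [set A : {set vertex H} |
    (#|A| == r.-1) && [exists B in edges H, A \subset B]].

Definition symdiff (T : finType) (A B : {set T}) : {set T} :=
  (A :\: B) :|: (B :\: A).

(* Not necessarily induced: edges of F must map to edges of H, while edges of H
   between vertices of the copy are unconstrained. *)
Definition contains_subgraph (r : nat) (H F : hypergraph r) : Prop :=
  exists2 f : vertex F -> vertex H, injective f &
    {in edges F, forall e : {set vertex F}, f @: e \in edges H}.

(* The family T_r; [uniq] makes the number of edges exactly three. *)
Definition in_Tr (r : nat) (F : hypergraph r) : Prop :=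
  #|vertex F| <= 2 * r - 1 /\
  exists A B C : {set vertex F},
    [/\ uniq [:: A; B; C], edges F = [set A; B; C] & symdiff A B \subset C].

Definition cancellative (r : nat) (H : hypergraph r) : Prop :=
  forall F : hypergraph r, in_Tr F -> ~ contains_subgraph H F.

(* Main.v *)
(** Induction on [r] through vertex links.  Write [h = #|H|], [s] for the size of
    the shadow and [d v] for the degree of [v].  The link of [v] is a cancellative
    [(r-1)]-graph with [d v] edges, and the sizes of the shadows of the links add up
    to at most [(r-1) s], so the induction hypothesis bounds the sum of the
    [d v ^ ((r-2)/(r-1))] by [s].  If [S] lay in the links of two vertices [v], [w] of
    an edge [E], then [S + v], [S + w], [E] would violate cancellativity; hence
    the links of the vertices of an edge are disjoint subsets of the shadow, and
    summing over the edges, the sum of the [d v ^ 2] is at most [h s].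
    Interpolating the exponent [1] between [(r-2)/(r-1)] and [2] yields
    [r h = \sum_v d v <= s h^(1/r)]. *)
Require Import Defs.
From mathcomp Require Import all_boot all_order all_algebra.
From mathcomp Require Import reals exp.
From mathcomp Require Import ring lra.
Set Implicit Arguments.
Unset Strict Implicit.
Unset Printing Implicit Defensive.
Import Order.TTheory GRing.Theory Num.Theory.
Local Open Scope ring_scope.

(** * Links and degree counts in cancellative set families *)

Section SetFamilies.
Variable T : finType.
Implicit Types (E : {set {set T}}) (A B C S : {set T}) (v w : T).

Definition uniform n E := {in E, forall A, #|A| = n}.

(** The form of [cancellative] for set families: without a bound on the number of vertices, it
    passes to links directly. *)
Definition cancelling E := forall A B C, A \in E -> B \in E -> C \in E ->
  uniq [:: A; B; C] -> ~~ (symdiff A B \subset C).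

Definition lower_shadow n E : {set {set T}} :=
  [set A : {set T} | (#|A| == n) && [exists B in E, A \subset B]].

Definition link E v : {set {set T}} := [set S : {set T} | (v \notin S) && (v |: S \in E)].

Lemma setU1_inj_notin v A B : v \notin A -> v \notin B -> v |: A = v |: B -> A = B.
Proof. by move=> vA vB eqAB; rewrite -(setU1K vA) eqAB setU1K. Qed.

Lemma link_uniform n E v : uniform n.+1 E -> uniform n (link E v).
Proof.
move=> unifE S; rewrite inE => /andP[vS vSE].
by have := unifE _ vSE; rewrite cardsU1 vS => -[].
Qed.

Lemma symdiff_setU1 v A B : symdiff (v |: A) (v |: B) \subset symdiff A B.
Proof.
by apply/subsetP=> x; rewrite !inE; case: (x == v); case: (x \in A); case: (x \in B).
Qed.

Lemma link_cancelling E v : cancelling E -> cancelling (link E v).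
Proof.
move=> cE A B C; rewrite !inE => /andP[vA AE] /andP[vB BE] /andP[vC CE] uABC.
apply: contra (cE _ _ _ AE BE CE _) => [sABC|].
  by rewrite (subset_trans (symdiff_setU1 v A B)) // (subset_trans sABC) ?subsetUr.
move: uABC; rewrite /= !inE !andbT !negb_or => /andP[/andP[nAB nAC] nBC].
have ne (X Y : {set T}) : v \notin X -> v \notin Y -> X != Y -> v |: X != v |: Y.
  by move=> vX vY; apply: contraNN => /eqP /(setU1_inj_notin vX vY) ->.
by rewrite !ne.
Qed.

Lemma sum_card_incident E :
  (\sum_v #|[set A in E | v \in A]| = \sum_(A in E) #|A|)%N.
Proof.
under eq_bigr do rewrite -sum1dep_card.
under [RHS]eq_bigr do rewrite -sum1_card.
rewrite (exchange_big_dep (mem E)) /= => [|v A _ /andP[] //].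
by apply: eq_bigr => A AE; apply: eq_bigl => v; rewrite AE.
Qed.

Lemma card_link E v : #|link E v| = #|[set A in E | v \in A]|.
Proof.
rewrite -(card_in_imset (f := fun S => v |: S)); last first.
  by move=> A B; rewrite !inE => /andP[vA _] /andP[vB _] /setU1_inj_notin; apply.
congr (#|pred_of_set _|); apply/setP=> A; rewrite inE; apply/imsetP/andP.
  by case=> S; rewrite inE => /andP[vS vSE] ->; rewrite vSE setU11.
by case=> AE vA; exists (A :\ v); rewrite ?inE ?setD1K // eqxx.
Qed.

Lemma sum_card_link n E : uniform n E -> (\sum_v #|link E v| = n * #|E|)%N.
Proof.
move=> unifE; under eq_bigr do rewrite card_link.
by rewrite sum_card_incident (eq_bigr _ unifE) sum_nat_const mulnC.
Qed.

(** Adding [v] is injective on these sets, since none of them contains [v]. *)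
Lemma card_lower_shadow_link n E v :
  (#|lower_shadow n (link E v)| <= #|[set A in lower_shadow n.+1 E | v \in A]|)%N.
Proof.
have notin S : S \in lower_shadow n (link E v) -> v \notin S.
  rewrite inE => /andP[_ /existsP[B /andP[]]]; rewrite inE => /andP[vB _] sSB.
  by apply: contra vB; apply: (subsetP sSB).
rewrite -(card_in_imset (f := fun S => v |: S)); last first.
  by move=> A B /notin vA /notin vB; apply: setU1_inj_notin.
apply/subset_leq_card/subsetP=> _ /imsetP[S SL ->].
have vS := notin S SL; move: SL.
rewrite !inE eqxx cardsU1 vS andbT eqSS => /andP[-> /existsP[B /andP[]]].
rewrite inE => /andP[_ BE] sSB; apply/existsP; exists (v |: B).
by rewrite BE setUS.
Qed.

Lemma sum_card_lower_shadow_link n E :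
  (\sum_v #|lower_shadow n (link E v)| <= n.+1 * #|lower_shadow n.+1 E|)%N.
Proof.
apply: (@leq_trans (\sum_v #|[set A in lower_shadow n.+1 E | v \in A]|)%N).
  by apply: leq_sum => v _; apply: card_lower_shadow_link.
rewrite sum_card_incident (eq_bigr (fun=> n.+1)) ?sum_nat_const 1?mulnC //.
by move=> A; rewrite inE => /andP[/eqP].
Qed.

Lemma link_sub_lower_shadow n E v :
  uniform n.+1 E -> link E v \subset lower_shadow n E.
Proof.
move=> unifE; apply/subsetP=> S SL; rewrite inE (link_uniform unifE SL) eqxx /=.
move: SL; rewrite inE => /andP[_ vSE].
by apply/existsP; exists (v |: S); rewrite vSE subsetUr.
Qed.

Lemma links_disjoint E A v w S : cancelling E -> A \in E ->
  v \in A -> w \in A -> S \in link E v -> S \in link E w -> v = w.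
Proof.
move=> cE AE vA wA; rewrite !inE => /andP[vS vSE] /andP[wS wSE].
apply/eqP; apply: contraT => nvw; have nwv : w != v by rewrite eq_sym.
have wnvS : w \notin v |: S by rewrite !inE negb_or nwv.
have vnwS : v \notin w |: S by rewrite !inE negb_or nvw.
have neq x (X Y : {set T}) : x \in X -> x \notin Y -> Y != X.
  by move=> xX; apply: contraNneq => ->.
(* The edges are distinct: [v |: S] misses [w], and [w |: S] misses [v]. The symmetric difference of
   these two contains only [v] and [w], both in [A]. *)
have /negP[] : ~~ (symdiff (v |: S) (w |: S) \subset A).
  apply: cE => //; rewrite /= !inE !andbT negb_or.
  by rewrite (neq w) ?setU11 // (neq w A) // (neq v A).
apply/subsetP=> x; rewrite !inE.
by case: eqP => [->|_] //; case: eqP => [->|_] //; case: (x \in S).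
Qed.

Lemma sum_card_link_edge n E A : uniform n.+1 E -> cancelling E -> A \in E ->
  (\sum_(v in A) #|link E v| <= #|lower_shadow n E|)%N.
Proof.
move=> unifE cE AE.
under eq_bigr do rewrite -sum1_card.
rewrite (exchange_big_dep (mem (lower_shadow n E))) /=; last first.
  by move=> v S _; apply: subsetP; apply: link_sub_lower_shadow.
rewrite -[leqRHS]sum1_card; apply: leq_sum => S _.
rewrite sum1dep_card; apply/card_le1P => v; rewrite inE => /andP[vA SLv] w.
rewrite [LHS]inE [RHS]inE; apply/idP/eqP => [/andP[wA SLw]|->]; last by rewrite vA.
exact: (links_disjoint cE AE wA vA SLw SLv).
Qed.

Lemma sum_card_link_sqr n E : uniform n.+1 E -> cancelling E ->
  (\sum_v #|link E v| ^ 2 <= #|E| * #|lower_shadow n E|)%N.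
Proof.
move=> unifE cE.
(* Summing degrees inside each edge counts the degree of [v] once per edge through [v]. *)
have -> : (\sum_v #|link E v| ^ 2 = \sum_(A in E) \sum_(v in A) #|link E v|)%N.
  rewrite (exchange_big_dep predT) //=; apply: eq_bigr => v _.
  by rewrite sum_nat_cond_const -mulnn {1}card_link.
rewrite -sum_nat_const; apply: leq_sum => A AE.
exact: sum_card_link_edge.
Qed.

End SetFamilies.

(** * Weighted AM-GM and interpolation of sums *)

Section Powers.
Variable R : realType.
Implicit Types a b c x y z : R.

Lemma bernoulli_homogeneous n x a : 0 <= x -> 0 <= a ->
  n.+1%:R * x * a ^+ n <= x ^+ n.+1 + n%:R * a ^+ n.+1.
Proof.
move=> x0 a0; elim: n => [|n IHn]; first by rewrite mul1r mulr1 mul0r addr0.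
(* This is exactly the slack left after multiplying the induction hypothesis by [x]. *)
have sq : 0 <= n.+1%:R * (a ^+ n * (x - a) ^+ 2).
  by apply: mulr_ge0 => //; apply: mulr_ge0; [apply: exprn_ge0 | apply: sqr_ge0].
have := ler_wpM2l x0 IHn; rewrite !exprS -!natr1 expr0 in sq *.
nra.
Qed.

Lemma young_power n x a b : 0 <= x -> 0 <= a -> 0 <= b ->
  x ^+ n.+1 <= a ^+ n * b -> n.+1%:R * x <= n%:R * a + b.
Proof.
move=> x0 a0 b0 xab; case: (eqVneq a 0) xab => [-> | an0 xab].
  case: n => [|n]; first by rewrite !expr1 !mul1r mul0r add0r.
  rewrite expr0n mul0r mulr0 add0r => xn.
  have /eqP : x ^+ n.+2 = 0 by apply/le_anti; rewrite xn exprn_ge0.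
  by rewrite expf_eq0 /= => /eqP ->; rewrite mulr0.
have ap : 0 < a by rewrite lt_def an0.
rewrite -(ler_pM2r (exprn_gt0 n ap)).
apply: le_trans (bernoulli_homogeneous n x0 a0) _.
by rewrite mulrDl -mulrA -exprS [b * _]mulrC addrC lerD2l.
Qed.

Lemma powRV_exprn n x : 0 <= x -> (x `^ n.+1%:R^-1) ^+ n.+1 = x.
Proof. by move=> x0; rewrite -powR_mulrn ?powR_ge0 // -powRrM mulVf ?pnatr_eq0 // powRr1. Qed.

(* [c] plays the role of [h^(1/r)] with [r = n.+1], and [z v] bounds
   [d v ^ ((r-2)/(r-1))]; the hypothesis [x v ^+ n.+1 <= ...] is that bound with
   the roots cleared. *)
Lemma sum_interpolation (I : finType) n (x z : I -> R) c s :
  0 < c -> 0 < s -> (forall v, 0 <= x v) -> (forall v, 0 <= z v) ->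
  (forall v, x v ^+ n.+1 <= z v ^+ n * x v ^+ 2) ->
  \sum_v z v <= s -> \sum_v x v ^+ 2 <= c ^+ n.+1 * s ->
  \sum_v x v <= s * c.
Proof.
move=> c0 s0 x0 z0 xz sz sx.
have cs0 : 0 < s * c by rewrite mulr_gt0.
have cn0 : 0 < c ^+ n.+1 * s by rewrite mulr_gt0 ?exprn_gt0.
(* Dividing by [s * c], [s] and [c ^+ n.+1 * s] makes the sums of the two terms on the right at most
   [n] and [1]. *)
have young v : n.+1%:R * (x v / (s * c))
    <= n%:R * (z v / s) + x v ^+ 2 / (c ^+ n.+1 * s).
  apply: young_power; rewrite ?divr_ge0 ?sqr_ge0 ?(ltW s0) ?(ltW cs0) ?(ltW cn0) //.
  rewrite !expr_div_n mulf_div.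
  have -> : s ^+ n * (c ^+ n.+1 * s) = (s * c) ^+ n.+1.
    by rewrite exprMn [s ^+ n.+1]exprS; ring.
  by rewrite ler_pM2r ?invr_gt0 ?exprn_gt0.
rewrite -[leRHS]mul1r -ler_pdivrMr // -(ler_pM2l (ltr0Sn R n)) mulr1.
rewrite mulr_suml mulr_sumr.
apply: le_trans (ler_sum _ (fun v _ => young v)) _.
rewrite big_split /= -mulr_sumr -!mulr_suml -[leRHS]natr1.
by rewrite lerD // ?ler_piMr // ler_pdivrMr // mul1r.
Qed.

End Powers.

(** * The bound for set families, by induction on uniformity *)

Lemma lower_shadow_gt0 (T : finType) n (E : {set {set T}}) :
  uniform n.+1 E -> E != set0 -> (0 < #|lower_shadow n E|)%N.
Proof.
move=> unifE /set0Pn[A AE]; have cA := unifE _ AE.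
have /card_gt0P[v vA] : (0 < #|A|)%N by rewrite cA.
apply/card_gt0P; exists (A :\ v); rewrite inE; apply/andP; split.
  by rewrite -eqSS -cA (cardsD1 v A) vA.
by apply/existsP; exists A; rewrite AE subsetDl.
Qed.

(** Here [r = n.+1]. Being linear in the shadow size, this form can be summed over the links. An
    empty [E] would fail at [n = 0], where the left side is [1]. *)
Lemma cancelling_lower_shadow_bound (R : realType) (T : finType) n (E : {set {set T}}) :
  uniform n.+1 E -> cancelling E -> E != set0 ->
  n.+1%:R * (#|E|%:R `^ n.+1%:R^-1) ^+ n <= #|lower_shadow n E|%:R :> R.
Proof.
elim: n E => [|n IHn] E unifE cE E0; have s0 := lower_shadow_gt0 unifE E0.
  by rewrite mul1r expr0 ler1n.
set c := _ `^ _; have h0 : (0 < #|E|)%N by rewrite card_gt0.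
have c0 : 0 < c by rewrite powR_gt0 ?ltr0n.
have cn : c ^+ n.+2 = #|E|%:R by apply: powRV_exprn.
(* Multiplying by [c] turns the left side into [n.+2 * #|E|], the sum of the degrees. *)
rewrite -(ler_pM2r c0) -mulrA -exprSr cn -natrM -(sum_card_link unifE) natr_sum.
apply: (@sum_interpolation R T n.+1 _
  (fun v => #|lower_shadow n (link E v)|%:R / n.+1%:R)); rewrite ?ltr0n //.
- by move=> v; rewrite divr_ge0.
- move=> v /=; have [-> | L0] := eqVneq (link E v) set0.
    by rewrite cards0 expr0n mulr_ge0 ?sqr_ge0 ?exprn_ge0 ?divr_ge0.
  have := IHn _ (link_uniform unifE) (link_cancelling (v := v) cE) L0.
  set d := _ `^ _ => dz; have d0 : 0 <= d by apply: powR_ge0.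
  rewrite -addn2 exprD ler_wpM2r ?sqr_ge0 //.
  (* Since the degree is [d ^+ n.+1], taking roots leaves [d ^+ n] to be bounded, which is the
     induction hypothesis. *)
  rewrite -[#|link E v|%:R](@powRV_exprn _ n) // -/d exprAC.
  rewrite lerXn2r ?nnegrE ?exprn_ge0 ?divr_ge0 //.
  by rewrite ler_pdivlMr ?ltr0n // mulrC.
- rewrite -mulr_suml ler_pdivrMr ?ltr0n // -natr_sum -natrM ler_nat mulnC.
  exact: sum_card_lower_shadow_link.
- rewrite cn -natrM; under eq_bigr do rewrite -natrX.
  by rewrite -natr_sum ler_nat sum_card_link_sqr.
Qed.

(** * From hypergraphs to set families, and the theorem *)

Lemma cancellative_cancelling r (H : hypergraph r) :
  cancellative H -> cancelling (edges H).
Proof.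
move=> cH A B C AH BH CH uABC; apply/negP => sABC.
(* The forbidden subgraph is carried by the union of the three edges, so that its vertex count can
   be bounded. *)
pose W := A :|: B :|: C; pose V := {x | x \in W}.
pose p (X : {set vertex H}) : {set V} := val @^-1: X.
have pK (X : {set vertex H}) : X \subset W -> val @: p X = X.
  move=> sXW; apply/setP=> x; apply/imsetP/idP => [[y] | xX].
    by rewrite inE => yX ->.
  by exists (Sub x (subsetP sXW x xX)); rewrite ?inE SubK.
have sAW : A \subset W by rewrite /W -setUA subsetUl.
have sBW : B \subset W by rewrite /W setUAC subsetUr.
have sCW : C \subset W by rewrite subsetUr.
have pE e : e \in [set p A; p B; p C] -> val @: e \in edges H.
  by rewrite !inE => /orP[/orP[]|] /eqP ->; rewrite pK.
have Funif : {in [set p A; p B; p C], forall e : {set V}, #|e| = r}.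
  by move=> e /pE /edges_uniform; rewrite card_imset //; apply: val_inj.
have nep (X Y : {set vertex H}) :
    X \subset W -> Y \subset W -> X != Y -> p X != p Y.
  by move=> /pK XK /pK YK; apply: contraNneq => pXY; rewrite -XK pXY YK.
move: (uABC); rewrite /= !inE !andbT !negb_or => /andP[/andP[nAB nAC] nBC].
case: (cH (Hypergraph Funif)); last by exists val; [apply: val_inj | apply: pE].
split; last first.
  exists (p A), (p B), (p C); split=> //.
    by rewrite /= !inE !negb_or !nep.
  by apply/subsetP=> x xAB; rewrite inE (subsetP sABC) //; move: xAB; rewrite !inE.
rewrite /= card_sig.
(* A vertex of [A] or [B] outside [C] lies in both, so [W] has at most [(r - 1) + r] vertices. *)
have sW : W \subset (A :&: B) :|: C.
  apply/subsetP=> x; have := subsetP sABC x; rewrite !inE.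
  by case: (x \in A); case: (x \in B) => //= ->.
have cAB : (#|A :&: B| < r)%N.
  suff: (#|A :&: B| < #|A|)%N by rewrite (edges_uniform AH).
  rewrite proper_card // properE subsetIl subsetI subxx /=.
  by apply: contra nAB => sAB; rewrite eqEcard sAB (edges_uniform AH) (edges_uniform BH) /=.
have := leq_trans (subset_leq_card sW) (leq_card_setU _ _).
rewrite (edges_uniform CH) => cW; have r0 := leq_ltn_trans (leq0n _) cAB.
by rewrite (leq_trans cW) // mul2n -addnn -addnBAC // leq_add2r subn1 -ltnS prednK.
Qed.

Theorem theorem4p4 (R : realType) (r : nat) (H : hypergraph r) :
  (2 <= r)%N -> cancellative H ->
  (#|edges H|%:R : R) <=
    (#|shadow H|%:R / r%:R) `^ (r%:R / (r%:R - 1)).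
Proof.
case: r H => [|[|n]] // H _ /cancellative_cancelling cE.
have [->|E0] := eqVneq (edges H) set0; first by rewrite cards0 powR_ge0.
have := cancelling_lower_shadow_bound R (@edges_uniform _ H) cE E0.
rewrite -/(shadow H) -powR_mulrn ?powR_ge0 // -powRrM.
rewrite mulrC -ler_pdivlMr ?ltr0n // => bound.
rewrite -natr1 addrK natr1.
(* With [r = n.+2], this exponent is the inverse of the one on the number of edges in [bound]. *)
have := ge0_ler_powR (r := n.+2%:R / n.+1%:R) _ _ _ bound.
rewrite -powRrM mulrACA mulVf ?mulfV ?pnatr_eq0 // mulr1 powRr1 //.
by apply; rewrite ?nnegrE ?powR_ge0 ?divr_ge0.
Qed.
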